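(* Let $f\in\mathbb{C}[X_1,X_2]$ be any irreducible polynomial such that the set $M((f))=\{\underline{z}\in\mathbb{B}^2 : f(\underline{z})=0\}$ is infinite and contained in $(\partial\mathbb{B})^2$. Then for every integer $k\ge1$, the closure of the ideal $(f^k)$ in $\mathbb{C}[X_1,X_2]$ with respect to the norm $\bigl\Vert\sum_{i,j} a_{ij}X_1^iX_2^j\bigr\Vert=\sum_{i,j}|a_{ij}|$ is $$\overline{(f^k)}=(f).$$
   Context: Here $\mathbb{B}=\{z\in\mathbb{C}:|z|\le 1\}$ is the closed unit disc and $\partial\mathbb{B}=\{z\in\mathbb{C}:|z|=1\}$ the unit circle. The closure is taken inside the normed algebra $\mathbb{C}[X_1,X_2]$ with the $\ell_1$-norm on coefficients. *)

(* Defs.v *)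
From HB Require Import structures.
From mathcomp Require Import all_boot all_order all_algebra.
From mathcomp Require Import complex.
From mathcomp Require Import mathcomp_extra boolp classical_sets functions.
From mathcomp Require Import cardinality reals topology normedtype.
(* The notations of multinomials have levels incompatible with those of
   mathcomp-analysis; everything else of mpoly is imported. *)
From mathcomp Require mpoly.
Export -(notations) mpoly.

Set Implicit Arguments.
Unset Strict Implicit.
Unset Printing Implicit Defensive.
Import Order.TTheory GRing.Theory Num.Theory.

Local Open Scope classical_set_scope.
Local Open Scope ring_scope.

Notation "{ 'mpoly' T [ n ] }" := (mpoly n T)
  (at level 0, T, n at level 2, format "{ 'mpoly'  T [ n ] }") : type_scope.

Section EllOneNorm.
Variables (n : nat) (K : numFieldType).
Implicit Types p q : {mpoly K[n]}.

Definition l1norm p : K := \sum_(m <- msupp p) `|mcoeff m p|.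

Lemma l1normE (s : seq (multinom n)) p :
  uniq s -> {subset msupp p <= s} -> l1norm p = \sum_(m <- s) `|mcoeff m p|.
Proof.
move=> us sub; rewrite (bigID (mem (msupp p))) /= [X in _ + X]big1 => [|m Hm].
  rewrite addr0 -big_filter; apply: perm_big; apply: uniq_perm.
  - exact: msupp_uniq.
  - exact: filter_uniq.
  - by move=> m; rewrite mem_filter; case: (boolP (m \in _)) => // /sub ->.
by rewrite memN_msupp_eq0 ?normr0.
Qed.

Lemma ler_l1normD p q : l1norm (p + q) <= l1norm p + l1norm q.
Proof.
pose s := undup (msupp p ++ msupp q).
have us : uniq s by exact: undup_uniq.
have sp : {subset msupp p <= s}.
  by move=> m pm; rewrite mem_undup mem_cat pm.
have sq : {subset msupp q <= s}.
  by move=> m qm; rewrite mem_undup mem_cat qm orbT.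
have spq : {subset msupp (p + q) <= s}.
  by move=> m /msuppD_le; rewrite mem_undup.
rewrite (l1normE us sp) (l1normE us sq) (l1normE us spq).
by rewrite -big_split /=; apply: ler_sum => m _; rewrite mcoeffD ler_normD.
Qed.

Lemma l1normZ (a : K) p : l1norm (a *: p) = `|a| * l1norm p.
Proof.
rewrite (l1normE (s := msupp p)) ?msupp_uniq //; last exact: msuppZ_le.
by rewrite /l1norm mulr_sumr; apply: eq_bigr => m _; rewrite mcoeffZ normrM.
Qed.

Lemma l1norm_eq0 p : l1norm p = 0 -> p = 0.
Proof.
move=> /eqP; rewrite psumr_eq0 => [/allP p0|m _]; last exact: normr_ge0.
apply/eqP; rewrite -msupp_eq0; case E: (msupp p) => [//|m s].
have pm : m \in msupp p by rewrite E mem_head.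
by have := p0 _ pm; rewrite /= normr_eq0 mcoeff_eq0 pm.
Qed.

(* `|p| is l1norm p, and closures are taken for it. As for `|z| with z : R[i],
   its values are nonnegative elements of K. *)
HB.instance Definition _ :=
  Lmodule_isNormed.Build K {mpoly K[n]} ler_l1normD l1normZ l1norm_eq0.

End EllOneNorm.

Definition principal_ideal (A : comNzRingType) (f : A) : set A :=
  [set g | exists q, g = q * f].

Definition irreducible (A : idomainType) (f : A) : Prop :=
  [/\ f != 0, f \isn't a GRing.unit &
      forall g h : A, f = g * h -> g \is a GRing.unit \/ h \is a GRing.unit].

(* bidisc_zeros f is the set M((f)). *)
Section Bidisc.
Variable R : realType.

Definition bidisc : set ('I_2 -> R[i]) := [set z | forall i, `|z i| <= 1].

Definition torus : set ('I_2 -> R[i]) := [set z | forall i, `|z i| = 1].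

Definition bidisc_zeros (f : {mpoly R[i][2]}) : set ('I_2 -> R[i]) :=
  bidisc `&` [set z | meval z f = 0].

End Bidisc.

(* Main.v *)
(** Evaluation at the points of the bidisc is continuous, so an element of the
    closure vanishes on the infinite set [M((f))] and is a multiple of the
    irreducible [f]. Conversely it suffices that [f] lies in the closure [J] of
    [(f^2)]. Restricting [f] to the complex lines [t |-> t v] through the origin
    turns [1/f] into a power series in [t] whose [n]-th coefficient is a form of
    degree [n] in [v], as [f(0) <> 0]. Let [theta f = X0 f_X0 + X1 f_X1]. A Bezout
    relation [a f + b theta f = c(X1)] with [c <> 0] gives
    [c/f = a + b t (f'/f)] on every line; the roots of [f] there lie outside the
    open unit disc, so the coefficients of [f'/f], which are power sums of the
    inverses of these roots, are bounded, and hence so are those of [c/f] on the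
    torus. A form of degree [n] bounded by [A] on the torus has l1-norm at most
    [A sqrt (n + 1)]. If [B_N] is the Cesaro mean of the first [N] partial sums of
    [c/f], then [f c - f^2 B_N = O(1/N)] except for boundedly many coefficients of
    index about [N], of size [O(N^(-1/2))]: thus [c f] is in [J]. Finally the
    linear factors [X1 - z] of [c] are removed one by one: modulo [X1 - z], [f] is
    a product of factors [X0 - x] over the zeros [(x, z)] of [f], each of which
    lies on the torus or outside the bidisc, so that multiples [g] of [f] can be
    approximated by elements of [((X0 - x) g, (X1 - z) g)]. *)

Require Import Defs.
From mathcomp Require Import all_boot all_order all_algebra complex.
From mathcomp Require Import classical_sets cardinality reals topology normedtype.
From mathcomp Require Import boolp cyclic separable cyclotomic ring zify.

Set Implicit Arguments.
Unset Strict Implicit.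
Unset Printing Implicit Defensive.
Import Order.TTheory GRing.Theory Num.Theory.

Local Open Scope classical_set_scope.
Local Open Scope ring_scope.

(** * The l1-norm and closures of principal ideals *)

Section EllOneAlgebra.
Variables (n : nat) (K : numFieldType).
Implicit Types (p q : {mpoly K[n]}) (m : multinom n).

Lemma normr_mpolyX m : `|mpolyX K m| = 1.
Proof.
change (l1norm (mpolyX K m) = 1).
by rewrite /l1norm msuppX big_seq1 mcoeffX eqxx normr1.
Qed.

Lemma normr_mpolyC (c : K) : `|mpolyC n c| = `|c|.
Proof.
by rewrite -alg_mpolyC normrZ -[1](mpolyX0 n K) normr_mpolyX mulr1.
Qed.

Lemma normr_mpolyMX p m : `|p * mpolyX K m| = `|p|.
Proof.
change (l1norm (p * mpolyX K m) = l1norm p).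
rewrite /l1norm (perm_big _ (msuppMX p m)) big_map.
by apply: eq_bigr => m' _; rewrite mcoeffMX.
Qed.

Lemma ler_normr_mpolyM p q : `|p * q| <= `|p| * `|q|.
Proof.
rewrite {1}(mpolyE q) mulr_sumr (le_trans (ler_norm_sum _ _ _)) //.
rewrite {3}/Num.norm /= /l1norm mulr_sumr; apply: ler_sum => m _.
by rewrite -scalerAr normrZ normr_mpolyMX mulrC.
Qed.

(** Points of the closed polydisc give contractive characters, so vanishing at such a point passes
    to closures. *)
Lemma ler_normr_meval p (v : 'I_n -> K) :
  (forall i, `|v i| <= 1) -> `|meval v p| <= `|p|.
Proof.
move=> v1; rewrite mevalE (le_trans (ler_norm_sum _ _ _)) //.
apply: ler_sum => m _; rewrite normrM ler_piMr // normr_prod.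
by apply: prodr_ile1 => i _; rewrite normrX exprn_ge0 ?exprn_ile1.
Qed.

Lemma closure_mpolyP (A : set {mpoly K[n]}) p :
  closure A p <-> forall e, 0 < e -> exists2 q, A q & (`|p - q| < e).
Proof.
split=> [clA e e0|H B].
  have [q [Aq pq]] := clA _ (nbhsx_ballx p e e0).
  by exists q => //; move: pq; rewrite -ball_normE.
rewrite -nbhs_ballE => -[e /= e0 eB]; have [q Aq pq] := H e e0.
by exists q; split=> //; apply: eB; rewrite -ball_normE.
Qed.

Implicit Types f g h : {mpoly K[n]}.

Lemma closure_idealP g h :
  closure (principal_ideal h) g <->
  forall e, 0 < e -> exists q, `|g - q * h| < e.
Proof.
split=> [/closure_mpolyP H e /H[_ [q ->] ?]|H]; first by exists q.
by apply/closure_mpolyP => e /H[q ?]; exists (q * h) => //; exists q.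
Qed.

Lemma closure_ideal_mem q h : closure (principal_ideal h) (q * h).
Proof. by apply: subset_closure; exists q. Qed.

Lemma closure_idealD f g h : closure (principal_ideal h) f ->
  closure (principal_ideal h) g -> closure (principal_ideal h) (f + g).
Proof.
move=> /closure_idealP Hf /closure_idealP Hg; apply/closure_idealP => e e0.
have e2 : 0 < e / 2 by rewrite divr_gt0.
have [a Ha] := Hf _ e2; have [b Hb] := Hg _ e2; exists (a + b).
rewrite (_ : _ - _ = f - a * h + (g - b * h)); last by ring.
by rewrite (le_lt_trans (ler_normD _ _)) // (splitr e) ltrD.
Qed.

(** The closure is closed, so the approximants may themselves be taken in it rather than in the
    ideal. *)
Lemma closure_ideal_lim g h :
  (forall e, 0 < e ->
     exists2 g', closure (principal_ideal h) g' & `|g - g'| < e) ->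
  closure (principal_ideal h) g.
Proof.
move=> H; rewrite ((closure_id _).1 (@closed_closure _ (principal_ideal h))).
by apply/closure_mpolyP.
Qed.

Lemma closure_idealM a g h :
  closure (principal_ideal h) g -> closure (principal_ideal h) (a * g).
Proof.
move=> /closure_idealP H; apply/closure_idealP => e e0.
have a0 : 0 < `|a| + 1 by rewrite ltr_wpDl.
have [q Hq] := H (e / (`|a| + 1)) (divr_gt0 e0 a0); exists (a * q).
rewrite -mulrA -mulrBr (le_lt_trans (ler_normr_mpolyM _ _)) //.
rewrite (@le_lt_trans _ _ ((`|a| + 1) * `|g - q * h|)) //.
  by rewrite ler_wpM2r // lerDl.
by rewrite mulrC -ltr_pdivlMr.
Qed.

Lemma closure_ideal_trans f g h : closure (principal_ideal g) f ->
  closure (principal_ideal h) g -> closure (principal_ideal h) f.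
Proof.
move=> /closure_idealP H gh; apply: closure_ideal_lim => e /H[q Hq].
by exists (q * g) => //; apply: closure_idealM.
Qed.

Lemma closure_ideal_mulr a g h : closure (principal_ideal h) g ->
  closure (principal_ideal (h * a)) (g * a).
Proof.
move=> /closure_idealP H; apply/closure_idealP => e e0.
have a0 : 0 < `|a| + 1 by rewrite ltr_wpDl.
have [q Hq] := H (e / (`|a| + 1)) (divr_gt0 e0 a0); exists q.
rewrite mulrA -mulrBl (le_lt_trans (ler_normr_mpolyM _ _)) //.
rewrite (@le_lt_trans _ _ (`|g - q * h| * (`|a| + 1))) //.
  by rewrite ler_wpM2l // lerDl.
by rewrite -ltr_pdivlMr.
Qed.

(** Multiplying the hypothesis by [f ^+ k] puts [f ^+ k.+1] in the closure of the ideal of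
    [f ^+ k.+2]; transitivity then drives the induction. *)
Lemma closure_ideal_exp f k : closure (principal_ideal (f ^+ 2)) f ->
  closure (principal_ideal (f ^+ k.+1)) f.
Proof.
move=> f2; elim: k => [|k IH]; first by rewrite expr1 -{2}[f]mul1r; exact: closure_ideal_mem.
apply: closure_ideal_trans IH _.
rewrite [f ^+ k.+1]exprS (_ : f ^+ k.+2 = f ^+ 2 * f ^+ k); first exact: closure_ideal_mulr.
by rewrite -exprD.
Qed.

End EllOneAlgebra.

(** * Cancelling factors inside a closed ideal *)

Section Removal.
Variables (n : nat) (K : numFieldType).
(** The Archimedean property, which turns bounds of order [1 / N] into convergence over an abstract
    field. *)
Hypothesis bounded_by_nat : forall x : K, exists N : nat, `|x| <= N%:R.
Implicit Types (f g h y : {mpoly K[n]}) (N : nat).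

Lemma ler_normr_mpolyX y N : `|y ^+ N| <= `|y| ^+ N.
Proof.
elim: N => [|N IH]; first by rewrite -[y ^+ 0]mpolyC1 normr_mpolyC normr1.
by rewrite !exprS (le_trans (ler_normr_mpolyM _ _)) // ler_wpM2l.
Qed.

Lemma small_div_nat (a e : K) : 0 <= a -> 0 < e -> exists N, a / N.+1%:R < e.
Proof.
move=> a0 e0; have [N HN] := bounded_by_nat (a / e); exists N.
rewrite ltr_pdivrMr ?ltr0n // mulrC -ltr_pdivrMr //.
rewrite -[a / e]ger0_norm ?divr_ge0 ?(ltW e0) //.
by rewrite (le_lt_trans HN) ?ltr_nat.
Qed.

(** In the completion [1 - y] is inverted by the geometric series: [(1 - y ^+ N) * g] is a multiple
    of [(1 - y) * g], and [y ^+ N * g] tends to 0. *)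
Lemma closure_ideal_geometric y g h : `|y| < 1 ->
  closure (principal_ideal h) ((1 - y) * g) -> closure (principal_ideal h) g.
Proof.
move=> y1 Hg; apply: closure_ideal_lim => e e0.
suff [N HN] : exists N, `|y| ^+ N * `|g| < e.
  exists ((1 - y ^+ N) * g).
    rewrite -opprB subrX1 -mulNr opprB mulrAC mulrC.
    exact: closure_idealM.
  rewrite (_ : _ - _ = y ^+ N * g); last by ring.
  rewrite (le_lt_trans _ HN) // (le_trans (ler_normr_mpolyM _ _)) //.
  by rewrite ler_wpM2r // ler_normr_mpolyX.
have [->|y0] := eqVneq y 0; first by exists 1; rewrite normr0 expr1 mul0r.
(* Bernoulli's inequality for the powers of [a] bounds those of the norm of [y] by a multiple of
   [1 / N], which the Archimedean property makes small. *)
pose a := `|y|^-1; have a1 : 0 < a - 1 by rewrite subr_gt0 invf_gt1 ?normr_gt0.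
have bern N : 1 + N%:R * (a - 1) <= a ^+ N.
  elim: N => [|N IH]; first by rewrite mul0r addr0.
  rewrite exprS -{2}(subrK 1 a) mulrDl mul1r -natr1 mulrDl mul1r addrA addrC lerD //.
  by rewrite ler_peMr ?(ltW a1) // exprn_ege1 // -subr_ge0 ltW.
have [N HN] := small_div_nat (divr_ge0 (normr_ge0 g) (ltW a1)) e0.
exists N.+1; rewrite (le_lt_trans _ HN) // mulrC -mulrA ler_wpM2l //.
rewrite -invfM -[`|y|]invrK exprVn lef_pV2 ?posrE;
  rewrite ?exprn_gt0 ?mulr_gt0 ?ltr0n ?invr_gt0 ?normr_gt0 //.
by rewrite mulrC (le_trans _ (bern _)) // lerDr.
Qed.

Lemma sum_subrX1 y N : N%:R - \sum_(k < N) y ^+ k =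
  (1 - y) * \sum_(k < N) \sum_(i < k) y ^+ i.
Proof.
rewrite mulr_sumr -[N in N%:R]card_ord -sumr_const -sumrB.
by apply: eq_bigr => k _; rewrite -opprB subrX1 -mulNr opprB.
Qed.

(* The ergodic means of [y1] and [y2] have norm at most [1], are [1] modulo
   [1 - y1] and [1 - y2], and annihilate [1 - y1] and [1 - y2] in the limit. *)
Lemma closure_ideal_means y1 y2 g h (a b : {mpoly K[n]}) :
  `|y1| <= 1 -> `|y2| <= 1 -> g = a * (1 - y1) + b * (1 - y2) ->
  closure (principal_ideal h) ((1 - y1) * g) ->
  closure (principal_ideal h) ((1 - y2) * g) -> closure (principal_ideal h) g.
Proof.
move=> y1_le1 y2_le1 Dg H1 H2; apply: closure_ideal_lim => e e0.
have [N HN] := small_div_nat (addr_ge0 (normr_ge0 (a *+ 2)) (normr_ge0 (b *+ 2))) e0.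
pose E y := N.+1%:R^-1 *: \sum_(k < N.+1) y ^+ k.
have N0 : N.+1%:R != 0 :> K by rewrite pnatr_eq0.
have pow y k : `|y| <= 1 -> `|y ^+ k| <= 1.
  by move=> yle; rewrite (le_trans (ler_normr_mpolyX _ _)) // exprn_ile1.
have E1 y : `|y| <= 1 -> `|E y| <= 1.
  move=> yle; rewrite normrZ ger0_norm ?invr_ge0 ?ler0n // mulrC ler_pdivrMr ?ltr0n //.
  rewrite mul1r (le_trans (ler_norm_sum _ _ _)) //.
  by rewrite -[N.+1 in leRHS]card_ord -sumr_const; apply: ler_sum => k _; apply: pow.
have EB y : 1 - E y = (N.+1%:R^-1 *: \sum_(k < N.+1) \sum_(i < k) y ^+ i) * (1 - y).
  rewrite -scalerAl mulrC -sum_subrX1 scalerBr; congr (_ - _).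
  by rewrite -scaler_nat scalerA mulVf // scale1r.
have Es y : `|y| <= 1 -> `|(1 - y) * E y| <= 2 / N.+1%:R.
  move=> yle; rewrite -scalerAr -opprB mulNr -subrX1 opprB normrZ mulrC.
  rewrite ger0_norm ?invr_ge0 ?ler0n // ler_wpM2r ?invr_ge0 ?ler0n //.
  rewrite (le_trans (ler_normB _ _)) // -[2]/(1 + 1) lerD ?pow //.
  by rewrite -[1]mpolyC1 normr_mpolyC normr1.
(* By [EB] this approximant is a sum of multiples of [(1 - y1) * g] and [(1 - y2) * g]. The error
   [E y1 * E y2 * g] is small by [Es], once [g] is written through [1 - y1] and [1 - y2]. *)
exists (g - E y1 * E y2 * g).
  rewrite (_ : _ - _ = (1 - E y1) * g + E y1 * ((1 - E y2) * g)); last by ring.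
  apply: closure_idealD; first by rewrite EB -mulrA; exact: closure_idealM.
  by apply: closure_idealM; rewrite EB -mulrA; exact: closure_idealM.
rewrite subKr (le_lt_trans _ HN) //.
have -> : E y1 * E y2 * g =
    a * E y2 * ((1 - y1) * E y1) + b * E y1 * ((1 - y2) * E y2).
  by rewrite Dg; ring.
have bound (c y z : {mpoly K[n]}) : `|y| <= 1 -> `|z| <= 1 ->
    `|c * E y * ((1 - z) * E z)| <= `|c *+ 2| / N.+1%:R.
  move=> yle zle; rewrite (le_trans (ler_normr_mpolyM _ _)) // normrMn.
  rewrite -[`|c| *+ 2]mulr_natr -mulrA.
  apply: ler_pM => //; last exact: Es.
  by rewrite (le_trans (ler_normr_mpolyM _ _)) // ler_piMr // E1.
by rewrite [leRHS]mulrDl (le_trans (ler_normD _ _)) // lerD // bound.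
Qed.

End Removal.

(** Congruence modulo the ideal [I] of the [v i - w i] respects sums and products, hence values of
    polynomials. *)
Lemma mmap_subr_ideal (n : nat) (K : comNzRingType) (S : comNzRingType)
    (c : {rmorphism K -> S}) (v w : 'I_n -> S) (p : {mpoly K[n]}) :
  exists a : 'I_n -> S,
    mmap c v p - mmap c w p = \sum_i a i * (v i - w i).
Proof.
pose I (x : S) := exists a : 'I_n -> S, x = \sum_i a i * (v i - w i).
have I0 : I 0 by exists (fun=> 0); rewrite big1 // => i _; rewrite mul0r.
have ID x y : I x -> I y -> I (x + y).
  move=> [a ->] [b ->]; exists (fun i => a i + b i); rewrite -big_split /=.
  by apply: eq_bigr => i _; rewrite mulrDl.
have IM z x : I x -> I (z * x).
  move=> [a ->]; exists (fun i => z * a i); rewrite mulr_sumr.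
  by apply: eq_bigr => i _; rewrite mulrA.
have IMM x x' y y' : I (x - x') -> I (y - y') -> I (x * y - x' * y').
  move=> Ix Iy; rewrite (_ : _ - _ = x * (y - y') + y' * (x - x')); last by ring.
  by apply: ID; apply: IM.
have Iv i : I (v i - w i).
  exists (fun j => (i == j)%:R); rewrite (bigD1 i) //= eqxx mul1r big1 ?addr0 //.
  by move=> j; rewrite eq_sym => /negbTE ->; rewrite mul0r.
change (I (mmap c v p - mmap c w p)); rewrite -sumrB.
elim/big_ind: _ => // m _; rewrite -mulrBr; apply: IM.
apply: (big_ind2 (fun x y => I (x - y))) => [|*|i _]; rewrite ?subrr //.
  exact: IMM.
by elim: (m i) => [|k IH]; rewrite ?subrr // !exprS; apply: IMM.
Qed.

Lemma mmap_mpolyX (n : nat) (K : comNzRingType) (p : {mpoly K[n]}) :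
  mmap (@mpolyC n K) (fun i => mpolyX K (mnm1 i)) p = p.
Proof.
rewrite [RHS]mpolyE; apply: eq_bigr => m _.
by rewrite mmap1_id mul_mpolyC.
Qed.

Lemma mmap_meval (n : nat) (K S : comNzRingType) (c : {rmorphism K -> S}) v (p : {mpoly K[n]}) :
  mmap c (fun i => c (v i)) p = c (meval v p).
Proof.
rewrite mevalE rmorph_sum; apply: eq_bigr => m _.
rewrite rmorphM rmorph_prod; congr (_ * _); apply: eq_bigr => i _.
by rewrite rmorphXn.
Qed.

Section RemovalPlane.
Variable K : numClosedFieldType.
Hypothesis bounded_by_nat : forall x : K, exists N : nat, `|x| <= N%:R.
Implicit Types f g h : {mpoly K[2]}.
Local Notation X i := (mpolyX K (mnm1 i)).

(** Up to a scalar, [X i - v i] is [1 - y i], where [y i] has norm the inverse of that of [v i].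
    Outside the bidisc some [y i] has norm below 1 and the geometric series applies. On the torus
    both have norm 1, and [g], vanishing at [v], lies in the ideal of the two [1 - y i], so the
    ergodic means apply. *)
Lemma closure_ideal_point (v : 'I_2 -> K) g h :
  ((forall i, `|v i| <= 1) -> forall i, `|v i| = 1) -> meval v g = 0 ->
  (forall i, closure (principal_ideal h) ((X i - mpolyC 2 (v i)) * g)) ->
  closure (principal_ideal h) g.
Proof.
move=> vT gv Hg; pose y i := (v i)^-1 *: X i.
have ny i : `|y i| = `|v i|^-1 by rewrite normrZ normr_mpolyX mulr1 normfV.
have y1 i : v i != 0 -> 1 - y i = - (v i)^-1 *: (X i - mpolyC 2 (v i)).
  move=> vi; rewrite scaleNr scalerBr opprB; congr (_ - _).
  by rewrite -alg_mpolyC scalerA mulVf // scale1r.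
have Hy i : v i != 0 -> closure (principal_ideal h) ((1 - y i) * g).
  by move=> vi; rewrite y1 // -scalerAl -mul_mpolyC; apply: closure_idealM.
have [[i vi]|/forallNP v1] := pselect (exists i, 1 < `|v i|).
  apply: (closure_ideal_geometric bounded_by_nat (y := y i)).
    by rewrite ny invf_lt1 ?(lt_trans ltr01).
  by apply: Hy; rewrite -normr_gt0 (lt_trans ltr01).
have {}v1 i : `|v i| = 1.
  by apply: vT => {}i; have /negP := v1 i; rewrite -real_leNgt ?normr_real ?real1.
have v0 i : v i != 0 by rewrite -normr_eq0 v1 oner_neq0.
have [a] := mmap_subr_ideal (@mpolyC 2 K) (fun i => X i) (fun i => mpolyC 2 (v i)) g.
rewrite mmap_meval gv mmap_mpolyX rmorph0 subr0 big_ord_recl big_ord1.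
set j := lift _ _ => Dg.
apply: (@closure_ideal_means _ _ bounded_by_nat (y ord0) (y j) _ _
  (- v ord0 *: a ord0) (- v j *: a j)); rewrite ?ny ?v1 ?invr1 //; try exact: Hy.
by rewrite Dg !y1 // -!scalerAr -!scalerAl !scalerA !mulrNN !mulVf // !scale1r.
Qed.

(** Modulo [X 1 - z], [f] is a nonzero constant times the product of the [X 0 - x] over the zeros
    [(x, z)] of [f]. As [f * f] lies in the closure, so does this product times [g * f]; its factors
    are then removed by [closure_ideal_point], since [f] vanishes at each [(x, z)]. *)
Lemma closure_ideal_line f h (z : K) :
  (forall v, meval v f = 0 -> (forall i, `|v i| <= 1) -> forall i, `|v i| = 1) ->
  mmap polyC (fun i : 'I_2 => if i == 0 then 'X else z%:P) f != 0 ->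
  closure (principal_ideal h) (f * f) ->
  forall g, closure (principal_ideal h) ((X 1 - mpolyC 2 z) * (g * f)) ->
  closure (principal_ideal h) (g * f).
Proof.
set p := mmap _ _ _ => fT p0 hf g Hg.
have [s Dp] := closed_field_poly_normal p.
have ps x : x \in s -> meval (fun i : 'I_2 => if i == 0 then x else z) f = 0.
  move=> xs; have : root p x by rewrite Dp rootZ ?lead_coef_eq0 // root_prod_XsubC.
  move=> /rootP <-; rewrite -/(horner_eval x p) /p {1}/mmap rmorph_sum mevalE.
  apply: eq_bigr => m _; rewrite rmorphM rmorph_prod /= {1}/horner_eval hornerC.
  congr (_ * _); apply: eq_bigr => i _; rewrite rmorphXn /= /horner_eval.
  by case: eqP => _; rewrite (hornerX, hornerC).
suff : closure (principal_ideal h) (\prod_(x <- s) (X 0 - mpolyC 2 x) * (g * f)).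
  elim: s {Dp} g ps Hg => [|x s IH] g ps Hg; first by rewrite big_nil mul1r.
  rewrite big_cons => Hs; apply: IH => //.
    by move=> y ys; apply: ps; rewrite inE ys orbT.
  pose v (i : 'I_2) := if i == 0 then x else z.
  have fv : meval v f = 0 by apply: ps; rewrite mem_head.
  apply: (@closure_ideal_point v); [exact: fT|by rewrite !rmorphM /= fv !mulr0|].
  move=> i; rewrite /v; have [->|i0] := eqVneq i 0; first by rewrite mulrA.
  have -> : i = 1 by apply/val_inj; case: i i0 => -[|[|]].
  rewrite mulrCA; exact: closure_idealM.
(* Replacing [X 1] by [z] changes [f] by [a 1 * (X 1 - z)], the coordinate [X 0] being kept. *)
have [a] := mmap_subr_ideal (@mpolyC 2 K) (fun i => X i)
  (fun i => if i == 0 then X 0 else mpolyC 2 z) f.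
rewrite mmap_mpolyX big_ord_recl big_ord1 /= subrr mulr0 add0r.
set j := lift _ _; have -> : j = 1 by apply/val_inj.
set p' := mmap _ _ _ => Df.
have Dp' : p' = lead_coef p *: \prod_(x <- s) (X 0 - mpolyC 2 x).
  pose ev (q : {poly K}) := (map_poly (@mpolyC 2 K) q).[X 0].
  have evC c : ev c%:P = mpolyC 2 c by rewrite /ev map_polyC hornerC.
  have evM : {morph ev : x y / x * y} by move=> x y; rewrite /ev rmorphM hornerM.
  transitivity (ev p).
    rewrite /ev /p [in RHS]/mmap rmorph_sum horner_sum; apply: eq_bigr => m _.
    rewrite -/(ev _) evM evC; congr (_ * _).
    rewrite /mmap1 big_ord_recl big_ord1 [in RHS]big_ord_recl big_ord1 /= evM.
    rewrite (_ : ev ('X ^+ _) = X 0 ^+ m ord0).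
      by rewrite -rmorphXn /= -[in RHS]rmorphXn /= evC.
    by rewrite /ev map_polyXn hornerXn.
  rewrite [in LHS]Dp -mul_polyC evM evC mul_mpolyC; congr (_ *: _).
  rewrite (big_morph ev evM (_ : ev 1 = 1)); last by rewrite -polyC1 evC mpolyC1.
  by apply: eq_bigr => x _; rewrite /ev rmorphB /= map_polyX map_polyC /= !hornerE.
have -> : \prod_(x <- s) (X 0 - mpolyC 2 x) = (lead_coef p)^-1 *: (f - a 1 * (X 1 - mpolyC 2 z)).
  by rewrite -Df subKr Dp' scalerA mulVf ?lead_coef_eq0 // scale1r.
rewrite -scalerAl -mul_mpolyC; apply: closure_idealM.
rewrite mulrBl; apply: closure_idealD; first by rewrite mulrCA; exact: closure_idealM.
by rewrite -mulrA -mulNr; exact: closure_idealM.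
Qed.

End RemovalPlane.

(** * Irreducible polynomials in two variables *)

Section PolyPolyIrreducible.
Variable K : closedFieldType.
Implicit Types (c : {poly K}) (f g q : {poly {poly K}}) (z : K).
Local Notation ev z := (map_poly (horner_eval z)).

Lemma map_horner_eval_eq0 z f :
  ev z f = 0 -> exists g, f = ('X - z%:P) *: g.
Proof.
move=> f0; exists (map_poly (fun c => c %/ ('X - z%:P)) f).
apply/polyP => i; rewrite coefZ coef_map_id0 ?div0p // mulrC divpK //.
rewrite dvdp_XsubCl; apply/rootP.
by move/polyP: f0 => /(_ i); rewrite coef_map coef0.
Qed.

Lemma size_poly_unit_le1 (A : idomainType) (p : {poly A}) :
  p \is a GRing.unit -> (size p <= 1)%N.
Proof. by rewrite poly_unitE => /andP[/eqP->]. Qed.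

(* Gauss' lemma: [K] being algebraically closed, a non-constant [c] has a linear
   factor [y - z], and [y - z] is prime because [K[x]] is a domain. *)
Lemma scaler_mul_split c f g q : c != 0 -> c *: f = g * q ->
  exists c1 c2 g' q',
    [/\ g = c1 *: g', q = c2 *: q' & f = g' * q'].
Proof.
elim: {c}(size c) {-2}c (leqnn (size c)) f g q => [|k IH] c.
  by rewrite leqn0 size_poly_eq0 => /eqP->; rewrite eqxx.
move=> ck f g q c0 cf.
have [sc|sc] := leqP (size c) 1.
  have [a a0 Dc] : exists2 a, a != 0 & c = a%:P.
    have := size1_polyC sc; set a := c`_0 => Dc; exists a => //.
    by apply: contraNneq c0 => a0; rewrite Dc a0.
  exists c, 1, (a^-1%:P *: g), q; split; rewrite ?scale1r //.
    by rewrite scalerA Dc -polyCM divff // scale1r.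
  by rewrite -scalerAl -cf scalerA Dc -polyCM mulVf // scale1r.
have [z /factor_theorem [d Dc]] : exists z, root c z.
  by apply/closed_rootP; rewrite gtn_eqF.
have d0 : d != 0 by apply: contraNneq c0 => d0; rewrite Dc d0 mul0r.
have sd : (size d <= k)%N.
  by move: ck; rewrite Dc size_Mmonic ?monicXsubC // size_XsubC addn2.
have zI (p p' : {poly {poly K}}) : ('X - z%:P) *: p = ('X - z%:P) *: p' -> p = p'.
  by rewrite -!mul_polyC; apply: mulfI; rewrite polyC_eq0 polyXsubC_eq0.
have : ev z g * ev z q = 0.
  rewrite -rmorphM /= -cf -mul_polyC rmorphM /= map_polyC /= /horner_eval.
  by rewrite Dc !hornerE subrr mulr0 mul0r.
move=> /eqP; rewrite mulf_eq0 => /orP[] /eqP /map_horner_eval_eq0[r Dr].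
  have /(IH _ sd)[//|c1 [c2 [g' [q' [Dg Dq Df]]]]] : d *: f = r * q.
    apply: zI; rewrite scalerA mulrC -Dc cf Dr.
    by rewrite scalerAl.
  by exists (('X - z%:P) * c1), c2, g', q'; rewrite -scalerA -Dg.
have /(IH _ sd)[//|c1 [c2 [g' [q' [Dg Dq Df]]]]] : d *: f = g * r.
  apply: zI; rewrite scalerA mulrC -Dc cf Dr.
  by rewrite scalerAr.
by exists c1, (('X - z%:P) * c2), g', q'; rewrite -scalerA -Dq.
Qed.

(** A nonzero resultant is the wanted [c]. If it vanishes, the gcd has positive degree; by Gauss'
    lemma and irreducibility [f] is this gcd up to scalars, so it divides a scalar multiple of
    [g]. *)
Lemma irreducible_bezout f g : irreducible f -> (1 < size f)%N ->
  (exists q, g = q * f) \/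
  exists a b c, c != 0 /\ a * f + b * g = c%:P.
Proof.
move=> [f0 _ f_irr] sf.
have [sg|sg] := leqP (size g) 1.
  have [->|g0] := eqVneq g 0; first by left; exists 0; rewrite mul0r.
  right; exists 0, 1, g`_0; rewrite mul0r add0r mul1r -size1_polyC //; split=> //.
  by apply: contraNneq g0 => g0; rewrite (size1_polyC sg) g0.
have [res0|res0] := eqVneq (resultant f g) 0; last first.
  by right; have [[a b] _ /= ?] := resultant_in_ideal sf sg; exists a, b, (resultant f g).
left; have /esym := resultant_eq0 f g; rewrite res0 eqxx; set d := gcdp f g => sd.
have /Pdiv.WeakIdomain.dvdpP[[/= c q] c0 cf] : d %| f by apply: dvdp_gcdl.
have [c1 [c2 [q' [d' [Dq Dd Df]]]]] := scaler_mul_split c0 cf.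
have q'U : q' \is a GRing.unit.
  have [//|/size_poly_unit_le1 d'1] := f_irr _ _ Df.
  by move: sd; rewrite Dd ltnNge (leq_trans (size_scale_leq _ _)).
have /Pdiv.WeakIdomain.dvdpP[[/= e r] e0 eg] : d %| g by apply: dvdp_gcdr.
have eg' : e *: g = (r * c2%:P / q') * f.
  by rewrite Df mulrA divrK // -mulrA mul_polyC -Dd.
(* Gauss' lemma again, now to cancel [e]: the content [c4] taken from [f] is a unit because [f] has
   positive degree. *)
have [c3 [c4 [r' [f' [_ Df' ->]]]]] := scaler_mul_split e0 eg'.
have [c4U|] : c4%:P \is a GRing.unit \/ f' \is a GRing.unit.
  by apply: f_irr; rewrite mul_polyC.
  by exists (r' / c4%:P); rewrite Df' -mul_polyC mulrA divrK.
move=> /size_poly_unit_le1 f'1.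
by move: sf; rewrite Df' ltnNge (leq_trans (size_scale_leq _ _)).
Qed.

(** Otherwise ['X - z%:P] would split off [f] as a non-unit of degree 0 in the outer variable,
    leaving a non-unit cofactor. *)
Lemma irreducible_map_horner_neq0 f z : irreducible f -> (1 < size f)%N ->
  ev z f != 0.
Proof.
move=> [f0 _ f_irr] sf; apply/eqP => /map_horner_eval_eq0[g Dg].
have [] : ('X - z%:P)%:P \is a GRing.unit \/ g \is a GRing.unit.
- by apply: f_irr; rewrite mul_polyC.
- rewrite poly_unitE size_polyC coefC /= => /andP[_].
  by rewrite poly_unitE size_XsubC.
- move=> /size_poly_unit_le1 g1.
  by move: sf; rewrite Dg ltnNge (leq_trans (size_scale_leq _ _)).
Qed.

End PolyPolyIrreducible.

Lemma rmorph_mmap (n : nat) (K S T : comNzRingType) (u : {rmorphism S -> T})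
    (c : {rmorphism K -> S}) (h : 'I_n -> S) (p : {mpoly K[n]}) :
  u (mmap c h p) = mmap (u \o c) (u \o h) p.
Proof.
rewrite rmorph_sum; apply: eq_bigr => m _; rewrite rmorphM rmorph_prod /=.
by congr (_ * _); apply: eq_bigr => i _; rewrite rmorphXn.
Qed.

Lemma eq_mmap (n : nat) (K S : comNzRingType) (c c' : K -> S) (h h' : 'I_n -> S)
    (p : {mpoly K[n]}) : c =1 c' -> h =1 h' -> mmap c h p = mmap c' h' p.
Proof.
move=> cc' hh'; apply: eq_bigr => m _; rewrite cc'; congr (_ * _).
by apply: eq_bigr => i _; rewrite hh'.
Qed.

Lemma big_I2 (S : Type) (idx : S) (op : Monoid.law idx) (F : 'I_2 -> S) :
  \big[op/idx]_i F i = op (F 0) (F 1).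
Proof.
by rewrite big_ord_recl big_ord1; congr (op _ (F _)); apply: val_inj.
Qed.

(** * Transfer between two-variable and iterated polynomials *)

Section PlanePolynomials.
Variable K : numClosedFieldType.
Implicit Types (f g : {mpoly K[2]}) (z : K).
Local Notation X i := (mpolyX K (mnm1 i)).

(* [K[X0, X1]] as [K[X1][X0]]. *)
Definition mpoly2_pp : {rmorphism {mpoly K[2]} -> {poly {poly K}}} :=
  mmap (polyC \o polyC) (fun i : 'I_2 => if i == 0 then 'X else ('X)%:P).

Definition poly_mpoly2 : {rmorphism {poly K} -> {mpoly K[2]}} :=
  horner_eval (X 1) \o map_poly (@mpolyC 2 K).

Definition pp_mpoly2 : {rmorphism {poly {poly K}} -> {mpoly K[2]}} :=
  horner_eval (X 0) \o map_poly poly_mpoly2.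

Lemma poly_mpoly2C z : poly_mpoly2 z%:P = mpolyC 2 z.
Proof. by rewrite /poly_mpoly2 /= map_polyC /horner_eval hornerC. Qed.

Lemma poly_mpoly2X : poly_mpoly2 'X = X 1.
Proof. by rewrite /poly_mpoly2 /= map_polyX /horner_eval hornerX. Qed.

Lemma pp_mpoly2C c : pp_mpoly2 c%:P = poly_mpoly2 c.
Proof. by rewrite /pp_mpoly2 /= map_polyC /horner_eval hornerC. Qed.

Lemma pp_mpoly2X : pp_mpoly2 'X = X 0.
Proof. by rewrite /pp_mpoly2 /= map_polyX /horner_eval hornerX. Qed.

Lemma mpoly2_ppC z : mpoly2_pp (mpolyC 2 z) = z%:P%:P.
Proof. exact: mmapC. Qed.

Lemma mpoly2_ppX i : mpoly2_pp (X i) = if i == 0 then 'X else ('X)%:P.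
Proof. by rewrite /mpoly2_pp /= mmapX mmap1U. Qed.

Lemma mpoly2_ppE f : mpoly2_pp f =
  mmap (polyC \o polyC) (fun i : 'I_2 => if i == 0 then 'X else ('X)%:P) f.
Proof. by []. Qed.

Opaque mpoly2_pp poly_mpoly2 pp_mpoly2.

Lemma mpoly2_ppK : cancel mpoly2_pp pp_mpoly2.
Proof.
move=> f; rewrite mpoly2_ppE rmorph_mmap -[RHS]mmap_mpolyX.
apply: eq_mmap => [z|i] /=; first by rewrite pp_mpoly2C poly_mpoly2C.
have [->|i0] := eqVneq i 0; first exact: pp_mpoly2X.
rewrite pp_mpoly2C poly_mpoly2X; congr (X _).
by apply/val_inj; case: i i0 => -[|[|]].
Qed.

Lemma pp_mpoly2K : cancel pp_mpoly2 mpoly2_pp.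
Proof.
have polyK (c : {poly K}) : mpoly2_pp (poly_mpoly2 c) = c%:P.
  elim/poly_ind: c => [|c z IH]; first by rewrite !rmorph0.
  by rewrite !rmorphD !rmorphM /= IH poly_mpoly2C poly_mpoly2X mpoly2_ppC mpoly2_ppX.
elim/poly_ind => [|P c IH]; first by rewrite !rmorph0.
by rewrite !rmorphD !rmorphM /= IH pp_mpoly2C polyK pp_mpoly2X mpoly2_ppX.
Qed.

Lemma irreducible_mpoly2_pp f : irreducible f -> irreducible (mpoly2_pp f).
Proof.
move=> [f0 fU f_irr]; split.
- by apply: contraNneq f0 => f0; rewrite -[f]mpoly2_ppK f0 rmorph0.
- by apply: contra fU => fU; rewrite -[f]mpoly2_ppK rmorph_unit.
move=> g h Df; have [] : pp_mpoly2 g \is a GRing.unit \/ pp_mpoly2 h \is a GRing.unit.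
- by apply: f_irr; rewrite -rmorphM -Df /= mpoly2_ppK.
- by move=> /(rmorph_unit mpoly2_pp); rewrite /= pp_mpoly2K; left.
- by move=> /(rmorph_unit mpoly2_pp); rewrite /= pp_mpoly2K; right.
Qed.

Lemma meval_mpoly2_pp f (v : 'I_2 -> K) :
  meval v f = (map_poly (horner_eval (v 1)) (mpoly2_pp f)).[v 0].
Proof.
rewrite -/(horner_eval (v 0) _).
rewrite mpoly2_ppE (rmorph_mmap (map_poly (horner_eval (v 1)))).
rewrite (rmorph_mmap (horner_eval (v 0))).
apply: eq_mmap => [z|i] /=; first by rewrite !map_polyC /= /horner_eval !hornerC.
have [->|i0] := eqVneq i 0; first by rewrite map_polyX /horner_eval hornerX.
rewrite map_polyC /= /horner_eval hornerX hornerC; congr (v _).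
by apply/val_inj; case: i i0 => -[|[|]].
Qed.

Lemma meval_poly_mpoly2 (c : {poly K}) (v : 'I_2 -> K) :
  meval v (poly_mpoly2 c) = c.[v 1].
Proof.
by rewrite -pp_mpoly2C meval_mpoly2_pp pp_mpoly2K map_polyC hornerC.
Qed.

Lemma poly_mpoly2_prod (z : K) (r : seq K) :
  poly_mpoly2 (z *: \prod_(x <- r) ('X - x%:P)) =
  mpolyC 2 z * \prod_(x <- r) (X 1 - mpolyC 2 x).
Proof.
rewrite -mul_polyC rmorphM rmorph_prod /= poly_mpoly2C; congr (_ * _).
by apply: eq_bigr => x _; rewrite rmorphB /= poly_mpoly2C poly_mpoly2X.
Qed.

Section Irreducible.
Variable f : {mpoly K[2]}.
Hypothesis f_irr : irreducible f.
Hypothesis f_size : (1 < size (mpoly2_pp f))%N.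

Lemma irreducible_mpoly2_bezout g :
  (exists q, g = q * f) \/
  exists a b (c : {poly K}), c != 0 /\ a * f + b * g = poly_mpoly2 c.
Proof.
have [[q Dg]|[a [b [c [c0 E]]]]] :=
  irreducible_bezout (mpoly2_pp g) (irreducible_mpoly2_pp f_irr) f_size.
  by left; exists (pp_mpoly2 q); rewrite -[f]mpoly2_ppK -rmorphM /= -Dg mpoly2_ppK.
right; exists (pp_mpoly2 a), (pp_mpoly2 b), c; split=> //.
by rewrite -pp_mpoly2C -E rmorphD !rmorphM /= !mpoly2_ppK.
Qed.

Lemma irreducible_mpoly2_line z :
  mmap polyC (fun i : 'I_2 => if i == 0 then 'X else z%:P) f != 0.
Proof.
have := irreducible_map_horner_neq0 z (irreducible_mpoly2_pp f_irr) f_size.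
rewrite mpoly2_ppE (rmorph_mmap (map_poly (horner_eval z))); congr (_ != 0).
apply: eq_mmap => [x|i] /=; first by rewrite map_polyC /= /horner_eval hornerC.
by case: eqP => _; rewrite (map_polyX, map_polyC) //= /horner_eval hornerX.
Qed.

(** If [g] is not a multiple of [f], a Bezout relation confines the second coordinate of a common
    zero to the roots of some [c != 0]. Over each of them [f] restricts to a nonzero polynomial, so
    the list [L] of candidates is finite. *)
Lemma irreducible_common_zeros g (A : set ('I_2 -> K)) : infinite_set A ->
  A `<=` [set v | meval v f = 0] -> A `<=` [set v | meval v g = 0] ->
  exists q, g = q * f.
Proof.
move=> infA fA gA; have [//|[a [b [c [c0 E]]]]] := irreducible_mpoly2_bezout g.
case: infA.
have [r Dr] := closed_field_poly_normal c.
pose s z := sval (closed_field_poly_normal (map_poly (horner_eval z) (mpoly2_pp f))).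
pose w (xy : K * K) (i : 'I_2) := if i == 0 then xy.1 else xy.2.
pose L := [seq (x, y) | y <- r, x <- s y].
apply: (@sub_finite_set _ _ (w @` [set` L])); last first.
  exact/finite_image/finite_seq.
move=> v Av; exists (v 0, v 1); last first.
  apply/funext => i; rewrite /w; have [->|i0] //= := eqVneq i 0.
  by congr (v _); apply/val_inj; case: i i0 => -[|[|]].
rewrite /= /L; apply/allpairsPdep; exists (v 1), (v 0); split=> //.
  have : root c (v 1).
    rewrite /root -meval_poly_mpoly2 -E rmorphD !rmorphM /=.
    by rewrite (fA _ Av) (gA _ Av) !mulr0 addr0.
  by rewrite Dr rootZ ?lead_coef_eq0 // root_prod_XsubC.
rewrite /s; case: closed_field_poly_normal => /= t Dt.
have : root (map_poly (horner_eval (v 1)) (mpoly2_pp f)) (v 0).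
  by rewrite /root -meval_mpoly2_pp (fA _ Av).
rewrite Dt rootZ ?root_prod_XsubC // lead_coef_eq0.
exact: irreducible_map_horner_neq0 (irreducible_mpoly2_pp f_irr) f_size.
Qed.

End Irreducible.
End PlanePolynomials.

(** * Bounds on coefficients *)

Section UnivariateBounds.
Variable K : numClosedFieldType.
Implicit Types (p q G Y U V : {poly K}) (r z : K).

Lemma prim_root_exists n : (0 < n)%N -> exists w : K, n.-primitive_root w.
Proof.
pose p : {poly K} := 'X^n - 1; have [r Dp] := closed_field_poly_normal p.
move=> n_gt0; rewrite (monicP _) ?monicXnsubC // scale1r in Dp.
have rn1 : all n.-unity_root r by apply/allP=> z; rewrite -root_prod_XsubC -Dp.
have sz_r : (n < (size r).+1)%N.
  by rewrite -(size_prod_XsubC r id) -Dp size_XnsubC.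
have [|z _ ?] := hasP (has_prim_root n_gt0 rn1 _ sz_r); last by exists z.
by rewrite -separable_prod_XsubC -Dp separable_Xn_sub_1 // pnatr_eq0 -lt0n.
Qed.

(** Cauchy-Schwarz against the constant vector: twice the difference of the two sides is the double
    sum of the [(a i - a j) ^+ 2]. *)
Lemma sqr_sum_le n (a : 'I_n -> K) : (forall i, 0 <= a i) ->
  (\sum_i a i) ^+ 2 <= n%:R * \sum_i a i ^+ 2.
Proof.
move=> a0; rewrite expr2 mulr_suml -(ler_pM2l (ltr0n K 2)).
have -> : 2 * (n%:R * \sum_i a i ^+ 2) = \sum_i \sum_j (a i ^+ 2 + a j ^+ 2).
  under [RHS]eq_bigr do rewrite big_split sumr_const card_ord /=.
  rewrite big_split /= sumr_const card_ord sumrMnl -mulr_natl; ring.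
rewrite mulr_sumr; apply: ler_sum => i _; rewrite mulr_sumr mulr_sumr.
apply: ler_sum => j _; rewrite -subr_ge0.
rewrite (_ : _ - _ = (a i - a j) ^+ 2); last by ring.
by rewrite real_exprn_even_ge0 // rpredB ?ger0_real.
Qed.

(** Discrete Parseval identity, from the orthogonality [orth] of the characters of the group of
    [n]-th roots of unity. *)
Lemma sum_sqr_horner_roots n w q : n.-primitive_root w -> (size q <= n)%N ->
  \sum_(j < n) `|q.[w ^+ j]| ^+ 2 = n%:R * \sum_(k < n) `|q`_k| ^+ 2.
Proof.
move=> wn qn; have n0 := prim_order_gt0 wn.
have wN : w ^+ n = 1 := prim_expr_order wn.
have w1 : `|w| = 1 by apply/eqP; rewrite -(@pexpr_eq1 _ _ n) // -normrX wN normr1.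
have w0 : w != 0 by rewrite -normr_eq0 w1 oner_neq0.
have wV k : (w ^+ k)^* = w ^- k.
  by rewrite [RHS]invC_norm normrX w1 !expr1n invr1 mul1r.
have orth (k l : 'I_n) : \sum_(j < n) w ^+ (j * k) * w ^- (j * l) = n%:R * (k == l)%:R.
  have [->|kl] := eqVneq k l.
    by rewrite (eq_bigr (fun=> 1)) ?sumr_const ?card_ord ?mulr1 // => j _; rewrite divff ?expf_neq0.
  rewrite mulr0 (eq_bigr (fun j : 'I_n => (w ^+ k / w ^+ l) ^+ j)); last first.
    by move=> j _; rewrite expr_div_n -!exprM ![(_ * j)%N]mulnC.
  have x1 : w ^+ k / w ^+ l - 1 != 0.
    rewrite subr_eq0; apply: contra kl => /eqP /(canRL (divfK _)) -/(_ (expf_neq0 _ w0)).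
    rewrite mul1r => /eqP; rewrite (eq_prim_root_expr wn) !modn_small //.
  apply: (mulfI x1); rewrite mulr0 -subrX1 expr_div_n -!exprM ![(_ * n)%N]mulnC !exprM wN.
  by rewrite !expr1n divr1 subrr.
transitivity (\sum_(j < n) \sum_(k < n) \sum_(l < n)
    q`_k * (q`_l)^* * (w ^+ (j * k) * w ^- (j * l))).
  apply: eq_bigr => j _; rewrite normCK (horner_coef_wide _ qn) rmorph_sum mulr_suml.
  apply: eq_bigr => k _; rewrite mulr_sumr; apply: eq_bigr => l _.
  by rewrite rmorphM /= -!exprM wV; ring.
rewrite exchange_big /= mulr_sumr; apply: eq_bigr => k _.
rewrite exchange_big /= (bigD1 k) //= -mulr_sumr orth eqxx mulr1 -normCK mulrC.
rewrite big1 ?addr0 // => l lk; rewrite -mulr_sumr orth eq_sym (negbTE lk).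
by rewrite !mulr0.
Qed.

Lemma sqr_sum_coef_le n q A : (size q <= n)%N ->
  (forall z, `|z| = 1 -> `|q.[z]| <= A) ->
  (\sum_(k < n) `|q`_k|) ^+ 2 <= A ^+ 2 * n%:R.
Proof.
case: n => [|n]; first by rewrite big_ord0 expr0n mulr0.
move=> qn qA; have [w wn] := prim_root_exists (ltn0Sn n).
apply: le_trans (sqr_sum_le _) _ => //; rewrite -(sum_sqr_horner_roots wn qn).
rewrite mulr_natr -[n.+1 in leRHS]card_ord -sumr_const; apply: ler_sum => j _.
have wj : `|w ^+ j| = 1.
  by apply/eqP; rewrite -(@pexpr_eq1 _ _ n.+1) // -normrX exprAC (prim_expr_order wn) expr1n normr1.
by rewrite lerXn2r ?nnegrE ?(le_trans (normr_ge0 _) (qA _ wj)) ?qA.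
Qed.

(** Below index [M], comparing coefficients gives a geometric progression: [r] times the first one
    is -1, and [r] times each next one is the preceding one. *)
Lemma coef_inv_XsubC_le1 M r Y V n : 1 <= `|r| ->
  ('X - r%:P) * Y = 1 - 'X^M * V -> (n < M)%N -> `|Y`_n| <= 1.
Proof.
move=> r1 E; have r0 : 0 < `|r| by rewrite (lt_le_trans ltr01).
elim: n => [|n IH] nM; have /polyP := E.
  move=> /(_ 0%N); rewrite mulrBl coefB coefXM coefCM coefB coef1 coefXnM nM /=.
  rewrite sub0r subr0 => /(congr1 Num.norm); rewrite normrN normr1 normrM => rY.
  by rewrite -rY ler_peMl.
move=> /(_ n.+1); rewrite mulrBl coefB coefXM coefCM coefB coef1 coefXnM nM /=.
rewrite subr0 => /subr0_eq YE; have := IH (ltnW nM); rewrite YE normrM.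
by apply: le_trans; rewrite ler_peMl.
Qed.

(** By the Leibniz rule each root [r] contributes one term, [Y] times the other factors, which is an
    inverse of ['X - r%:P] modulo ['X^M]. *)
Lemma coef_deriv_prod_XsubC_le M (s : seq K) Y V n :
  {in s, forall r, 1 <= `|r|} ->
  \prod_(r <- s) ('X - r%:P) * Y = 1 - 'X^M * V -> (n < M)%N ->
  `|((\prod_(r <- s) ('X - r%:P))^`() * Y)`_n| <= (size s)%:R.
Proof.
elim: s Y => [|r s IH] Y s1 E nM.
  by rewrite big_nil -polyC1 derivC mul0r coef0 normr0.
rewrite big_cons derivM derivXsubC mul1r mulrDl coefD -natr1 addrC.
rewrite (le_trans (ler_normD _ _)) // lerD //.
  rewrite mulrAC mulrC; apply: IH => // [x xs|]; first by rewrite s1 // inE xs orbT.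
  by rewrite -E big_cons; ring.
apply: (@coef_inv_XsubC_le1 M r _ V) => //; first by rewrite s1 ?mem_head.
by rewrite -E big_cons; ring.
Qed.

(* [G'/G] is the sum of the geometric series [1 / (x - r)] over the roots [r]. *)
Lemma coef_log_deriv_le M G U V n :
  (forall r, root G r -> 1 <= `|r|) -> G * U = 1 - 'X^M * V -> (n < M)%N ->
  `|(G^`() * U)`_n| <= (size G)%:R.
Proof.
move=> G1 E nM; have G0 : G != 0.
  case: M E nM => [//|M] E _; apply/eqP => G0.
  move/polyP: E => /(_ 0%N); rewrite G0 mul0r coef0 coefB coef1 coefXnM subr0.
  by move/eqP; rewrite eq_sym oner_eq0.
have [s Ds] := closed_field_poly_normal G.
have c0 : lead_coef G != 0 by rewrite lead_coef_eq0.
have s1 : {in s, forall r, 1 <= `|r|}.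
  by move=> r rs; apply: G1; rewrite Ds rootZ // root_prod_XsubC.
(* The leading coefficient is moved from [G] to [U], leaving a monic product and its truncated
   inverse. *)
rewrite Ds derivZ -scalerAl scalerAr; apply: le_trans (@coef_deriv_prod_XsubC_le M s _ V _ s1 _ nM) _.
  by rewrite -scalerAr scalerAl -Ds.
by rewrite size_scale // size_prod_XsubC ler_nat.
Qed.

End UnivariateBounds.

Section Homogeneous.
Variable K : numClosedFieldType.
Local Notation X i := (mpolyX K (mnm1 i)).
Local Notation homog k := (ishomog1 k mdeg).

(** The subtraction is truncated, so the degree is [n] only for [k <= n]; injectivity in [k] holds
    throughout, by the second exponent. *)
Definition mon2 n k : multinom 2 :=
  mnm_add (mnm_muln (mnm1 0) (n - k)) (mnm_muln (mnm1 1) k).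

Lemma mon2E n k : mon2 n k 0 = (n - k)%N /\ mon2 n k 1 = k.
Proof. by split; rewrite mnmDE !mulmnE !mnm1E /= !(mul0n, mul1n) ?addn0. Qed.

Lemma mon2_mdeg (m : multinom 2) : mon2 (mdeg m) (m 1) = m.
Proof.
rewrite mdegE big_I2 /=; apply/mnmP => i; have [E0 E1] := mon2E (m 0 + m 1) (m 1).
have [->|i0] := eqVneq i 0; first by rewrite E0 addnK.
have -> : i = 1 by apply/val_inj; case: i i0 => -[|[|]].
by rewrite E1.
Qed.

(* A form of degree [n] has [n + 1] coefficients, those of its dehomogenization:
   by Cauchy-Schwarz and Parseval this costs only the factor [sqrt (n + 1)]. *)
Lemma sqr_normr_homog_le n (p : {mpoly K[2]}) (A : K) : p \is homog n ->
  (forall z, `|z| = 1 -> `|meval (fun i => if i == 0 then 1 else z) p| <= A) ->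
  `|p| ^+ 2 <= A ^+ 2 * n.+1%:R.
Proof.
move=> pn pA; pose q := \poly_(k < n.+1) mcoeff (mon2 n k) p.
have mon_inj : injective (mon2 n).
  by move=> k l E; rewrite -(mon2E n k).2 E (mon2E n l).2.
pose s := [seq mon2 n k | k <- index_iota 0 n.+1].
have us : uniq s by rewrite map_inj_uniq ?iota_uniq.
have ps : {subset msupp p <= s}.
  move=> m pm; have mn := dhomog_mf pn pm; rewrite -(mon2_mdeg m) mn.
  apply: map_f; rewrite mem_index_iota /= ltnS -mn.
  by have := mdegE m; rewrite big_I2 /= => ->; rewrite leq_addl.
have sum_s (F : multinom 2 -> K) : \sum_(m <- msupp p) mcoeff m p * F m =
    \sum_(k < n.+1) mcoeff (mon2 n k) p * F (mon2 n k).
  rewrite -(big_mkord xpredT (fun k => mcoeff (mon2 n k) p * F (mon2 n k))).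
  rewrite -(big_map (mon2 n) xpredT (fun m => mcoeff m p * F m)) -/s.
  rewrite [RHS](bigID (mem (msupp p))) /= [Z in _ + Z]big1 ?addr0; last first.
    by move=> m /memN_msupp_eq0 ->; rewrite mul0r.
  rewrite -[RHS]big_filter; apply/perm_big/uniq_perm.
  - exact: msupp_uniq.
  - exact: filter_uniq.
  - by move=> m; rewrite mem_filter; case: (boolP (m \in _)) => // /ps ->.
have -> : `|p| = \sum_(k < n.+1) `|q`_k|.
  change (l1norm p = \sum_(k < n.+1) `|q`_k|).
  rewrite (l1normE us ps) big_map big_mkord; apply: eq_bigr => k _.
  by rewrite coef_poly ltn_ord.
apply: sqr_sum_coef_le => [|z z1]; first exact: size_poly.
rewrite (le_trans _ (pA z z1)) // mevalE sum_s (horner_coef_wide _ (size_poly _ _)).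
rewrite le_eqVlt; apply/orP; left; apply/eqP; congr `|_|.
apply: eq_bigr => k _; rewrite coef_poly ltn_ord big_I2 /= expr1n mul1r.
by rewrite (mon2E n k).2.
Qed.

End Homogeneous.

(** * Grading by total degree and restriction to lines through the origin *)

Section Dilation.
Variable K : numClosedFieldType.
Implicit Types (f a b : {mpoly K[2]}) (P Q : {poly {mpoly K[2]}}) (v : 'I_2 -> K).
Local Notation X i := (mpolyX K (mnm1 i)).
Local Notation homog k := (ishomog1 k mdeg).

Definition dilation : {rmorphism {mpoly K[2]} -> {poly {mpoly K[2]}}} :=
  mmap (polyC \o @mpolyC 2 K) (fun i => (X i)%:P * 'X).

Definition ray v : {rmorphism {mpoly K[2]} -> {poly K}} :=
  mmap polyC (fun i => (v i)%:P * 'X).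

(** The operator theta of the overview, which multiplies each monomial by its degree; on a line it
    becomes [t d/dt]. *)
Definition euler f : {mpoly K[2]} :=
  \sum_(m <- msupp f) (mcoeff m f *+ mdeg m) *: mpolyX K m.

(** The outer variable records total degree, so that coefficients of truncated quotients are forms,
    as [sqr_normr_homog_le] requires. *)
Definition graded P := forall k, P`_k \is homog k.

Lemma gradedC (c : K) : graded (mpolyC 2 c)%:P.
Proof.
move=> k; rewrite coefC; case: k => [|k]; last exact: dhomog0.
by rewrite /= -alg_mpolyC dhomogZ // dhomog1.
Qed.

Lemma gradedD P Q : graded P -> graded Q -> graded (P + Q).
Proof. by move=> HP HQ k; rewrite coefD dhomogD ?HP ?HQ. Qed.

Lemma gradedM P Q : graded P -> graded Q -> graded (P * Q).
Proof.
move=> HP HQ k; rewrite coefM; apply: rpred_sum => i _.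
by have := dhomogM (HP i) (HQ (k - i)%N); rewrite subnKC // -ltnS.
Qed.

Lemma gradedX P n : graded P -> graded (P ^+ n).
Proof.
move=> HP; elim: n => [|n IH]; first by rewrite expr0 -polyC1 -(@mpolyC1 2 K); exact: gradedC.
by rewrite exprS; apply: gradedM.
Qed.

Lemma graded_sum (I : Type) (r : seq I) (F : I -> {poly {mpoly K[2]}}) :
  (forall i, graded (F i)) -> graded (\sum_(i <- r) F i).
Proof. by move=> HF k; rewrite coef_sum; apply: rpred_sum => i _; apply: HF. Qed.

Lemma graded_dilation f : graded (dilation f).
Proof.
apply: graded_sum => m; apply: gradedM; first exact: gradedC.
rewrite /mmap1 big_I2; apply: gradedM; apply: gradedX => k;
  rewrite coefCM coefX; case: k => [|[|k]] /=;
  by rewrite ?mulr0 ?mulr1 ?dhomog0 // dhomogX; apply/eqP/mdeg1.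
Qed.

Lemma map_meval_dilation v f : map_poly (meval v) (dilation f) = ray v f.
Proof.
rewrite /dilation /= (rmorph_mmap (map_poly (meval v))).
apply: eq_mmap => [c|i] /=; first by rewrite map_polyC /= mevalC.
by rewrite rmorphM /= map_polyC map_polyX /= mevalXU.
Qed.

Lemma horner1_dilation f : (dilation f).[1] = f.
Proof.
rewrite -/(horner_eval _ _) /dilation /= (rmorph_mmap (horner_eval 1)) -[RHS]mmap_mpolyX.
by apply: eq_mmap => [c|i]; rewrite /= /horner_eval !hornerE.
Qed.

Lemma coef0_dilation f : (dilation f)`_0 = mpolyC 2 (meval (fun=> 0) f).
Proof.
rewrite -horner_coef0 -/(horner_eval _ _) /dilation /= (rmorph_mmap (horner_eval 0)).
rewrite -(mmap_meval (@mpolyC 2 K)).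
by apply: eq_mmap => [c|i]; rewrite /= /horner_eval !hornerE ?mpolyC0.
Qed.

Lemma horner_ray v f t : (ray v f).[t] = meval (fun i => v i * t) f.
Proof.
rewrite -/(horner_eval _ _) /ray /= (rmorph_mmap (horner_eval t)).
by apply: eq_mmap => [c|i]; rewrite /= /horner_eval !hornerE.
Qed.

Lemma ray_mpolyX v m : ray v (mpolyX K m) = mmap1 v m *: 'X^(mdeg m).
Proof.
rewrite /ray /= mmapX /mmap1 !big_I2 mdegE big_I2 /= !exprMn -mul_polyC.
by rewrite exprD rmorphM !rmorphXn /=; ring.
Qed.

Lemma rayE v f :
  ray v f = \sum_(m <- msupp f) (mcoeff m f * mmap1 v m) *: 'X^(mdeg m).
Proof.
rewrite {1}[f]mpolyE rmorph_sum; apply: eq_bigr => m _.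
by rewrite -mul_mpolyC rmorphM ray_mpolyX /ray /= mmapC mul_polyC scalerA.
Qed.

Lemma ray_euler v f : ray v (euler f) = 'X * (ray v f)^`().
Proof.
rewrite [in RHS]rayE (linear_sum (@deriv K)) mulr_sumr rmorph_sum; apply: eq_bigr => m _.
rewrite -mul_mpolyC rmorphM ray_mpolyX {1}/ray /= mmapC mul_polyC derivZ derivXn.
rewrite !scalerA -scalerAr mulrnAr mulrnAl -scalerMnl scalerMnr; congr (_ *: _).
by case: (mdeg m) => [|k] /=; rewrite ?mulr0n // exprS.
Qed.

End Dilation.

(** * Approximation modulo the square of the polynomial *)

Section CesaroIdentity.
Variable A : comNzRingType.
Implicit Types P Q F U V c : {poly A}.

Lemma coefM_low N P Q : (forall k, (k <= N)%N -> Q`_k = 0) ->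
  forall k, (k <= N)%N -> (P * Q)`_k = 0.
Proof.
move=> Q0 k kN; rewrite coefM big1 // => i _.
by rewrite Q0 ?mulr0 // (leq_trans (leq_subr _ _)).
Qed.

(** This is [N] times the Cesaro mean of the first [N] partial sums of [c * U]: the term of index
    [n] occurs in [N - n] of them. Without the division it makes sense over any commutative ring. *)
Definition cesaro N c U : {poly A} := \poly_(n < N) ((c * U)`_n *+ (N - n)).

(* Modulo [x^(N+1)], [F U = 1] and [cesaro N c U = (N - x d/dx) (c / F)]. *)
Lemma coef_cesaro N F U V c k : F * U = 1 - 'X^(N.+1) * V -> (k <= N)%N ->
  (F * c *+ N - F ^+ 2 * cesaro N c U)`_k = ('X * (F * c^`() - c * F^`()))`_k.
Proof.
move=> FU kN; set E := 'X^(N.+1) * V.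
have E0 j : (j <= N)%N -> E`_j = 0 by move=> jN; rewrite coefXnM ltnS jN.
have XE'0 j : (j <= N)%N -> ('X * E^`())`_j = 0.
  by case: j => [|j] jN; rewrite coefXM //= coef_deriv E0 ?mul0rn.
pose D := cesaro N c U - ((c * U) *+ N - 'X * (c * U)^`()).
have D0 j : (j <= N)%N -> D`_j = 0.
  move=> jN; rewrite !coefB coef_poly coefMn coefXM coef_deriv.
  have -> : (if j == 0 then 0 else (c * U)`_j.-1.+1 *+ j.-1.+1) = (c * U)`_j *+ j.
    by case: j jN => [|j] jN; rewrite ?mulr0n.
  (* At [j = N] the truncation loses nothing, the weight [N - j] being 0. *)
  rewrite -mulrnBr //; case: ltnP => jN'; first by rewrite subrr.
  by rewrite (eqP (_ : N - j == 0)%N) ?subrr // subn_eq0.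
have d1 : (1 : {poly A})^`() = 0 by rewrite -polyC1 derivC.
have -> : F * c *+ N - F ^+ 2 * cesaro N c U = 'X * (F * c^`() - c * F^`())
   - F ^+ 2 * D - c * F * ('X * E^`())
   + (c * F *+ N - 'X * F * c^`() + 'X * c * F^`()) * E.
  rewrite /D derivM; have -> : E = 1 - F * U by rewrite FU subKr.
  by rewrite derivB d1 !derivM; ring.
by rewrite coefD !coefB !(coefM_low _ D0, coefM_low _ XE'0, coefM_low _ E0) // !subr0 addr0.
Qed.

End CesaroIdentity.

Section MainEstimate.
Variable K : numClosedFieldType.
Implicit Types (f a b c : {mpoly K[2]}) (P Q U V : {poly {mpoly K[2]}}) (v : 'I_2 -> K).

Definition coef_norm P : K := \sum_(i < size P) `|P`_i|.

Lemma coef_norm_ge0 P : 0 <= coef_norm P.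
Proof. by apply: sumr_ge0. Qed.

Lemma sum_coef_le P m : \sum_(i < m) `|P`_i| <= coef_norm P.
Proof.
have [mP|Pm] := leqP m (size P).
  rewrite /coef_norm (big_ord_widen _ (fun i => `|P`_i|) mP) big_mkcond /=.
  by apply: ler_sum => i _; case: ifP.
rewrite /coef_norm (big_ord_widen _ (fun i => `|P`_i|) (ltnW Pm)) [leRHS]big_mkcond /=.
by apply: ler_sum => i _; case: ltnP => // Pi; rewrite nth_default // normr0.
Qed.

Lemma coef_le P n : `|P`_n| <= coef_norm P.
Proof.
by rewrite (le_trans _ (sum_coef_le P n.+1)) // big_ord_recr /= lerDr sumr_ge0.
Qed.

(* With [G] the restriction of [f] to the complex line through [v], the relation
   gives [c / f = a + b t G' / G] there, and [G' / G] has bounded coefficients. *)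
Lemma coef_quotient_le f a b c U V M v n :
  (forall w : 'I_2 -> K, (forall i, `|w i| < 1) -> meval w f != 0) ->
  a * f + b * euler f = c -> (forall i, `|v i| <= 1) ->
  dilation K f * U = 1 - 'X^M * V -> (n < M)%N ->
  `|meval v (dilation K c * U)`_n| <=
    coef_norm (dilation K a) + coef_norm (dilation K b) * (size (dilation K f))%:R.
Proof.
move=> fD <- v1 fU nM; set G := ray v f.
pose U' := map_poly (meval v) U; pose V' := map_poly (meval v) V.
have GU : G * U' = 1 - 'X^M * V'.
  rewrite /G -map_meval_dilation -rmorphM /= fU rmorphB rmorph1 rmorphM /=.
  by rewrite map_polyXn.
(* A root of modulus below 1 would scale [v] into the open bidisc, where [f] has no zero. *)
have G1 r : root G r -> 1 <= `|r|.
  move=> /rootP; rewrite horner_ray => fr; rewrite real_leNgt ?real1 ?normr_real //.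
  apply/negP => r1; suff /fD : forall i, `|v i * r| < 1 by rewrite fr eqxx.
  by move=> i; rewrite normrM (le_lt_trans _ r1) // ler_piMl.
have ray_le d k : `|(ray v d)`_k| <= `|(dilation K d)`_k|.
  by rewrite -map_meval_dilation coef_map; apply: ler_normr_meval.
rewrite -coef_map rmorphM /= -/U' map_meval_dilation rmorphD !rmorphM /= ray_euler -/G.
have -> : (ray v a * G + ray v b * ('X * G^`())) * U' =
    ray v a - 'X^M * (ray v a * V') + ray v b * ('X * (G^`() * U')).
  by have -> : 'X^M * (ray v a * V') = ray v a * (1 - G * U'); [rewrite GU|]; ring.
rewrite coefD coefB coefXnM nM subr0 (le_trans (ler_normD _ _)) // lerD //.
  by rewrite (le_trans (ray_le _ _)) // coef_le.
rewrite coefM (le_trans (ler_norm_sum _ _ _)) //.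
rewrite (le_trans _ (ler_wpM2r (ler0n _ _) (sum_coef_le (dilation K b) n.+1))) //.
rewrite mulr_suml; apply: ler_sum => i _; rewrite normrM ler_pM //.
rewrite coefXM; case: ifP => [_|ni]; first by rewrite normr0 ler0n.
rewrite (le_trans (coef_log_deriv_le G1 GU _)) //.
  by rewrite (leq_ltn_trans _ nM) // (leq_trans (leq_pred _)) // leq_subr.
by rewrite ler_nat /G -map_meval_dilation size_poly.
Qed.

Lemma horner1_le P m : (size P <= m)%N -> `|P.[1]| <= \sum_(k < m) `|P`_k|.
Proof.
move=> Pm; rewrite (horner_coef_wide _ Pm) (le_trans (ler_norm_sum _ _ _)) //.
by apply: ler_sum => k _; rewrite expr1n mulr1.
Qed.

(** Up to index [N] the coefficients are those of a polynomial independent of [N]. Beyond, at most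
    [size (F ^+ 2)] indices remain, and only the last coefficients of [cesaro N C U] reach them,
    whose weights are below [size (F ^+ 2)]. *)
Lemma horner1_cesaro_le (F C U V : {poly {mpoly K[2]}}) N (w : K) :
  0 <= w -> F * U = 1 - 'X^(N.+1) * V -> (size (F * C)%R <= N)%N ->
  (forall n, (n < N)%N -> `|(C * U)`_n| <= w) ->
  `|(F * C *+ N - F ^+ 2 * cesaro N C U).[1]| <=
    coef_norm ('X * (F * C^`() - C * F^`())) +
    coef_norm (F ^+ 2) * (size (F ^+ 2))%:R * (size (F ^+ 2))%:R * w.
Proof.
move=> w0 FU sFC Hw; set P := _ - _; set Q := 'X * _; set d := size (F ^+ 2).
have PQ k : (k <= N)%N -> P`_k = Q`_k by move=> kN; exact: (coef_cesaro C FU kN).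
have Phigh k : (N < k)%N -> `|P`_k| <= coef_norm (F ^+ 2) * (d%:R * w).
  move=> Nk; rewrite coefB coefMn (nth_default _ (leq_trans sFC (ltnW Nk))) mul0rn sub0r.
  rewrite normrN coefM (le_trans (ler_norm_sum _ _ _)) //.
  rewrite (le_trans _ (ler_wpM2r _ (sum_coef_le (F ^+ 2) k.+1))) ?mulr_ge0 //.
  rewrite mulr_suml; apply: ler_sum => i _.
  rewrite (le_trans (ler_normr_mpolyM _ _)) //.
  have [di|id] := leqP d i; first by rewrite nth_default // normr0 !mul0r.
  rewrite ler_wpM2l // coef_poly; case: ifP => [kiN|_]; last by rewrite normr0 mulr_ge0.
  rewrite normrMn -[_ *+ (N - _)]mulr_natl ler_pM ?ler0n ?Hw // ler_nat.
  by rewrite leq_subLR; lia.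
apply: le_trans (horner1_le (m := N.+1 + d) _) _.
  rewrite (leq_trans (size_polyD _ _)) // geq_max size_polyN; apply/andP; split.
    apply/leq_sizeP => k Nk; rewrite coefMn nth_default ?mul0rn //.
    by rewrite (leq_trans sFC) // (leq_trans _ Nk) // (leq_trans (leqnSn N)) ?leq_addr.
  rewrite (leq_trans (size_polyMleq _ _)) //.
  by rewrite (leq_trans (leq_pred _)) // addnC leq_add // (leq_trans (size_poly _ _)).
rewrite big_split_ord /= lerD //.
  rewrite (le_trans _ (sum_coef_le Q N.+1)) //; apply: ler_sum => k _.
  by rewrite PQ // -ltnS.
apply: (@le_trans _ _ (\sum_(k < d) coef_norm (F ^+ 2) * (d%:R * w))).
  by apply: ler_sum => k _; apply: Phigh; rewrite addSn ltnS leq_addr.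
by rewrite sumr_const card_ord -mulr_natr le_eqVlt; apply/orP; left; apply/eqP; ring.
Qed.

(** Setting the dilation variable to 1 returns to two variables, and dividing by [L] restores the
    Cesaro mean. *)
Lemma horner1_combination (F C B : {poly {mpoly K[2]}}) f c L (d : K) :
  F.[1] = f -> C.[1] = c -> `|(F * C *+ L - F ^+ 2 * B).[1]| <= d ->
  (0 < L)%N -> `|c * f - (L%:R^-1 *: B.[1]) * f ^+ 2| <= L%:R^-1 * d.
Proof.
rewrite hornerD hornerN hornerMn !hornerM => -> -> Hd L0.
have L0' : L%:R != 0 :> K by rewrite pnatr_eq0 -lt0n.
have -> : c * f - (L%:R^-1 *: B.[1]) * f ^+ 2 =
    L%:R^-1 *: ((f * c) *+ L - f * f * B.[1]).
  rewrite scalerBr -scaler_nat scalerA mulVf // scale1r -scalerAl.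
  by rewrite mulrC [B.[1] * _]mulrC -expr2.
by rewrite normrZ ger0_norm ?invr_ge0 // ler_wpM2l ?invr_ge0.
Qed.

Lemma closure_ideal_bezout f a b c :
  (forall x : K, exists N : nat, `|x| <= N%:R) ->
  (forall v : 'I_2 -> K, (forall i, `|v i| < 1) -> meval v f != 0) ->
  a * f + b * euler f = c -> closure (principal_ideal (f ^+ 2)) (c * f).
Proof.
move=> bounded_by_nat fD Dc; set F := dilation K f; set C := dilation K c.
set f0 := meval (fun=> 0) f.
have f00 : f0 != 0 by apply: fD => i; rewrite normr0 ltr01.
pose g : {poly {mpoly K[2]}} := (mpolyC 2 f0^-1)%:P.
(* The truncated geometric series for the inverse of [F]: as [1 - g * F] has constant coefficient 0,
   its power of exponent [N.+1] is divisible by ['X^(N.+1)]. *)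
pose U N : {poly {mpoly K[2]}} := g * \sum_(k < N.+1) (1 - g * F) ^+ k.
have [V FU] : exists V : nat -> {poly {mpoly K[2]}},
    forall N, F * U N = 1 - 'X^(N.+1) * V N.
  have /factor_theorem[q Dq] : root (1 - g * F) 0.
    rewrite /root !hornerE horner_coef0 coef0_dilation -mpolyCM mulVf //.
    by rewrite mpolyC1 subrr.
  exists (fun N => q ^+ N.+1) => N; rewrite mulrA [F * g]mulrC.
  have {1}-> : g * F = - (1 - g * F - 1) by rewrite opprB subKr.
  by rewrite mulNr -subrX1 opprB Dq subr0 exprMn mulrC.
pose w0 := coef_norm (dilation K a) + coef_norm (dilation K b) * (size F)%:R.
have w0_ge0 : 0 <= w0 by rewrite addr_ge0 ?mulr_ge0 ?coef_norm_ge0.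
have gU N : graded (C * U N).
  apply: gradedM; first exact: graded_dilation.
  apply: gradedM; first exact: gradedC.
  apply: graded_sum => k; apply: gradedX; apply: gradedD.
    by rewrite -polyC1 -(@mpolyC1 2 K); exact: gradedC.
  by rewrite -mulNr -polyCN -mpolyCN; apply: gradedM; [exact: gradedC|exact: graded_dilation].
(* The number of terms is a square, so that [M] bounds the square root of [n + 1] for
   [n < M ^ 2]. *)
have Hw M n : (n < M ^ 2)%N -> `|(C * U (M ^ 2)%N)`_n| <= w0 * M%:R.
  move=> nM; rewrite -(@ler_pXn2r _ 2) ?nnegrE ?mulr_ge0 //.
  apply: le_trans (sqr_normr_homog_le (A := w0) (gU _ _) _) _.
    move=> z z1; apply: (coef_quotient_le fD Dc _ (FU (M ^ 2)%N)); last by rewrite ltnS ltnW.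
    by move=> i; case: eqP => _; rewrite ?normr1 ?z1.
  by rewrite exprMn ler_wpM2l ?exprn_ge0 // -natrX ler_nat.
pose C1 := coef_norm ('X * (F * C^`() - C * F^`())) +
  coef_norm (F ^+ 2) * (size (F ^+ 2))%:R * (size (F ^+ 2))%:R * w0.
have C1_ge0 : 0 <= C1 by rewrite !(addr_ge0, mulr_ge0, coef_norm_ge0).
apply/closure_idealP => e e0.
have [N HN] := small_div_nat bounded_by_nat C1_ge0 e0.
(* The final bound is [C1 / M], small once [M] exceeds [N]; the size condition of
   [horner1_cesaro_le] then holds at [M ^ 2]. *)
have [M [NM sFC]] : exists M, (N < M)%N /\ (size (F * C)%R <= M)%N.
  by exists (N.+1 + size (F * C)%R)%N; rewrite leq_addr leq_addl.
have M0 : (0 < M)%N by apply: leq_ltn_trans NM.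
have {sFC} sFC : (size (F * C)%R <= M ^ 2)%N.
  by rewrite (leq_trans sFC) // expnS expn1 leq_pmulr.
have {FU} FU := FU (M ^ 2)%N; have {Hw} Hw := Hw M.
have MR : (M ^ 2)%:R = M%:R ^+ 2 :> K by rewrite natrX.
have MR0 : 0 < M%:R :> K by rewrite ltr0n.
have := horner1_cesaro_le (mulr_ge0 w0_ge0 (ltW MR0)) FU sFC Hw.
move: (M ^ 2)%N MR {FU Hw sFC} => L MR.
move=> /(horner1_combination (horner1_dilation f) (horner1_dilation c)) H1.
have L0 : (0 < L)%N by rewrite -(ltr0n K) MR exprn_gt0.
eexists; apply: le_lt_trans (H1 L0) (le_lt_trans _ HN).
apply: (@le_trans _ _ (L%:R^-1 * (C1 * M%:R))).
  rewrite ler_wpM2l ?invr_ge0 //.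
  rewrite [leRHS]mulrDl [leRHS]addrC [leLHS]addrC mulrA lerD //.
  by rewrite ler_peMr ?coef_norm_ge0 // ler1n.
have -> : L%:R^-1 * (C1 * M%:R) = C1 / M%:R by rewrite MR; field; rewrite gt_eqF.
by rewrite ler_wpM2l // lef_pV2 ?posrE ?ltr0n // ler_nat.
Qed.

End MainEstimate.

(** * Membership of [f] in the closure of the ideal of [f ^+ 2], and the theorem *)

Section IrreducibleClosure.
Variable K : numClosedFieldType.
Hypothesis bounded_by_nat : forall x : K, exists N : nat, `|x| <= N%:R.
Implicit Types f g : {mpoly K[2]}.

Lemma euler_not_multiple f (v : 'I_2 -> K) : meval (fun=> 0) f != 0 ->
  meval v f = 0 -> ~ exists q, euler f = q * f.
Proof.
move=> f0 fv [q /(congr1 (ray v))]; rewrite ray_euler rmorphM /=.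
set G := ray v f => E.
have G0 : G`_0 != 0.
  by rewrite -horner_coef0 horner_ray (meval_eq (v2 := fun=> 0)) // => i; rewrite mulr0.
have G1 : G.[1] = 0.
  by rewrite horner_ray -[RHS]fv; apply: meval_eq => i; rewrite mulr1.
have sG : (1 < size G)%N.
  rewrite ltnNge; apply: contra_neqN G0 => /size1_polyC G_C.
  by move: G1; rewrite G_C hornerC coefC.
have G_neq0 : G != 0 by rewrite -size_poly_gt0 ltnW.
have sG' : (size ('X * G^`())%R <= size G)%N.
  rewrite (leq_trans (size_polyMleq _ _)) // size_polyX addSn add1n.
  exact: lt_size_deriv.
have q0 : (ray v q)`_0 = 0.
  move/polyP: E => /(_ 0%N); rewrite coefXM coef0M => /esym/eqP.
  by rewrite mulf_eq0 (negbTE G0) orbF => /eqP.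
have [rq0|rq0] := eqVneq (ray v q) 0.
  move: sG; rewrite ltnNge => /negP; apply; apply/leq_sizeP => -[//|k] _.
  move/polyP: E => /(_ k.+1); rewrite rq0 mul0r coefXM coef_deriv coef0 => /eqP.
  by rewrite mulrn_eq0 => /eqP.
have : (1 < size (ray v q))%N.
  rewrite ltnNge; apply: contra_neqN rq0 => /size1_polyC ->.
  by rewrite q0.
move: sG'; rewrite E size_mul // -subn1 leq_subLR leq_add2r => le1.
by rewrite ltnNge le1.
Qed.

Lemma closure_ideal_sqr f (v : 'I_2 -> K) : irreducible f ->
  (1 < size (mpoly2_pp _ f))%N ->
  (forall w, meval w f = 0 -> (forall i, `|w i| <= 1) -> forall i, `|w i| = 1) ->
  meval v f = 0 -> closure (principal_ideal (f ^+ 2)) f.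
Proof.
move=> f_irr sf fT fv.
have fD (w : 'I_2 -> K) : (forall i, `|w i| < 1) -> meval w f != 0.
  move=> w1; apply/eqP => /fT H.
  by have := w1 0; rewrite H ?ltxx // => i; exact: ltW.
have [q|[a [b [c [c0 Dc]]]]] := irreducible_mpoly2_bezout f_irr sf (euler f).
  by case: (euler_not_multiple (fD (fun=> 0) _) fv) => // i; rewrite normr0.
have := closure_ideal_bezout bounded_by_nat fD Dc.
have [r Dr] := closed_field_poly_normal c.
rewrite [in poly_mpoly2 K c]Dr poly_mpoly2_prod.
move=> /(closure_idealM (a := mpolyC 2 (lead_coef c)^-1)).
rewrite !mulrA -mpolyCM mulVf ?lead_coef_eq0 // mpolyC1 mul1r.
(* The factors [X 1 - z] of [c] are removed one at a time, [f * f] being in the ideal itself. *)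
elim: r {Dr} => [|z r IH]; first by rewrite big_nil mul1r.
rewrite big_cons -mulrA => /(closure_ideal_line bounded_by_nat fT) H.
apply/IH/H; first exact: irreducible_mpoly2_line.
by rewrite -expr2 -{2}[f ^+ 2]mul1r; exact: closure_ideal_mem.
Qed.

End IrreducibleClosure.

Lemma complex_bounded_by_nat (R : realType) (x : R[i]) : exists N : nat, `|x| <= N%:R.
Proof.
rewrite normc_def; set y := Num.sqrt _; exists (Num.bound y).
by rewrite -(rmorph_nat (real_complex R)) lecR ltW // archi_boundP // sqrtr_ge0.
Qed.

Theorem theorem1p9 (R : realType) (f : {mpoly R[i][2]})
    (f_irr : irreducible f)
    (Mf_infinite : infinite_set (bidisc_zeros f))
    (Mf_torus : bidisc_zeros f `<=` @torus R)
    (k : nat) (k_ge1 : (1 <= k)%N) :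
  closure (principal_ideal (f ^+ k)) = principal_ideal f.
Proof.
have fT w : meval w f = 0 -> (forall i, `|w i| <= 1) -> forall i, `|w i| = 1.
  by move=> fw w1; apply: Mf_torus; split.
have [v [v1 fv]] : bidisc_zeros f !=set0 by exact: infinite_setN0.
(* If [f] involved only the second variable, moving the first coordinate of a zero in the bidisc to
   0 would give a zero in the bidisc off the torus. *)
have sf : (1 < size (mpoly2_pp _ f))%N.
  rewrite ltnNge; apply/negP => /size1_polyC.
  set c := _`_0 => Dc.
  pose w (i : 'I_2) := if i == 0 then 0 else v 1.
  have Df : f = poly_mpoly2 _ c by rewrite -pp_mpoly2C -Dc mpoly2_ppK.
  have /fT : meval w f = 0 by rewrite -fv Df !meval_poly_mpoly2.
  have w1 i : `|w i| <= 1.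
    by rewrite /w; case: eqP => _; rewrite ?normr0 ?ler01 // v1.
  by move=> /(_ w1 0) /eqP; rewrite normr0 eq_sym oner_eq0.
apply/seteqP; split=> [g /closure_idealP gf|_ [q ->]].
  (* At a point of M((f)) all multiples of [f ^+ k] vanish, as [k >= 1]; contractivity of evaluation
     then bounds the value of [g] by every [e > 0]. *)
  apply: (irreducible_common_zeros f_irr sf Mf_infinite); first by move=> w [].
  move=> w [w1 fw] /=; apply/eqP; rewrite -normr_le0 -(lerD2r 0); apply/ler_addgt0Pl.
  move=> e e0; rewrite !addr0; have [q Hq] := gf e e0.
  have := ler_normr_meval (g - q * f ^+ k) w1.
  rewrite rmorphB rmorphM rmorphXn /= fw expr0n gtn_eqF // mulr0 subr0 => H.
  by rewrite (le_trans H) // ltW.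
apply: closure_idealM; rewrite -(prednK k_ge1); apply: closure_ideal_exp.
exact: (closure_ideal_sqr (@complex_bounded_by_nat R) f_irr sf fT fv).
Qed.
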